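(* Let $M_3$ be a timelike helicoidal surface of type III in $\mathbb{E}^n_1$ ($n\ge4$), parametrized by $$H_3(u,v)=x_1(u)e_1+\sqrt2\,v\,x_n(u)e_2+x_3(u)e_3+\cdots+x_{n-2}(u)e_{n-2}+(x_{n-1}(u)+v^2x_n(u)+cv)\xi_{n-1}+x_n(u)\xi_n$$ with $c>0$, let $\phi_0>0$ be a constant, and let $\alpha_3(t)=H_3(u(t),v(t))$ be a smooth curve on $M_3$ with $\dot u(t)\neq0$ for all $t$. Then $\alpha_3$ is a timelike loxodrome with constant angle $\phi_0$ if and only if the following differential equation is satisfied for all $t$ (with $u=u(t)$, $v=v(t)$ and dots denoting derivatives with respect to $t$): (i) if the meridians of $M_3$ are spacelike ($\varepsilon=1$), $$(2\sinh^2\phi_0\,x_n^2(u)+c^2x_n'^2(u))\,\dot v^2-2c\cosh^2\phi_0\,x_n'(u)\,\dot u\dot v+\cosh^2\phi_0\,\dot u^2=0;$$ (ii) if the meridians of $M_3$ are timelike ($\varepsilon=-1$), $$(2\cosh^2\phi_0\,x_n^2(u)+c^2x_n'^2(u))\,\dot v^2-2c\sinh^2\phi_0\,x_n'(u)\,\dot u\dot v-\sinh^2\phi_0\,\dot u^2=0.$$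
   Context: $\mathbb{E}^n_1$ is $\mathbb{R}^n$ with the metric $\langle\cdot,\cdot\rangle$ given by $dx_1^2+\cdots+dx_{n-1}^2-dx_n^2$, and $\|w\|=\sqrt{|\langle w,w\rangle|}$. A vector $w$ is spacelike if $\langle w,w\rangle>0$ or $w=0$, timelike if $\langle w,w\rangle<0$; a curve is timelike if its velocity is timelike everywhere. Let $\{e_1,\dots,e_n\}$ be the standard orthonormal basis and $\xi_{n-1}=\frac1{\sqrt2}(e_n-e_{n-1})$, $\xi_n=\frac1{\sqrt2}(e_n+e_{n-1})$, so that $\langle\xi_{n-1},\xi_{n-1}\rangle=\langle\xi_n,\xi_n\rangle=0$ and $\langle\xi_{n-1},\xi_n\rangle=-1$. Helicoidal surface of type III: let $I\subset\mathbb{R}$ be an open interval, $\beta(u)=x_1(u)e_1+x_3(u)e_3+\cdots+x_{n-2}(u)e_{n-2}+x_{n-1}(u)\xi_{n-1}+x_n(u)\xi_n$, $u\in I$, a smooth regular curve parametrized by arc length, i.e. $x_1'^2+x_3'^2+\cdots+x_{n-2}'^2-2x_{n-1}'x_n'=\varepsilon$ with $\varepsilon\in\{1,-1\}$ constant, and $c>0$ a constant (for $n=4$ only the terms $e_1,e_2,\xi_3,\xi_4$ occur). The surface is parametrized by $H_3$ ($u\in I$, $v\in\mathbb{R}$). It is timelike if $EG-F^2<0$ everywhere, where $E=\langle (H_3)_u,(H_3)_u\rangle$, $F=\langle (H_3)_u,(H_3)_v\rangle$, $G=\langle (H_3)_v,(H_3)_v\rangle$; equivalently $2\varepsilon x_n^2(u)-c^2x_n'^2(u)<0$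 for all $u$. The meridians are the curves $u\mapsto H_3(u,v_0)$ with $v_0$ constant; they are spacelike if $\varepsilon=1$ and timelike if $\varepsilon=-1$. Lorentzian angle: for $x$ nonzero spacelike and $y$ timelike, the angle is the unique $\theta\ge0$ with $\langle x,y\rangle=\pm\|x\|\|y\|\sinh\theta$; for $x,y$ both timelike, it is the unique $\theta\ge 0$ with $\langle x,y\rangle=\pm\|x\|\|y\|\cosh\theta$. A timelike loxodrome with constant angle $\phi_0$ is a timelike curve $\alpha_3(t)=H_3(u(t),v(t))$ such that, for every $t$, the Lorentzian angle between $\dot\alpha_3(t)$ and the meridian tangent vector $(H_3)_u(u(t),v(t))$ equals $\phi_0$. *)

(* Defs.v *)
From HB Require Import structures.
From mathcomp Require Import all_boot all_order all_algebra.
From mathcomp Require Import all_classical all_reals all_analysis.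
Set Implicit Arguments.
Unset Strict Implicit.
Unset Printing Implicit Defensive.
Import Order.TTheory GRing.Theory Num.Theory.
Import numFieldNormedType.Exports.
Local Open Scope classical_set_scope.
Local Open Scope ring_scope.

Definition sinh (R : realType) (x : R) : R := (expR x - expR (- x)) / 2.

Definition cosh (R : realType) (x : R) : R := (expR x + expR (- x)) / 2.

(* Coordinates are numbered from 1 in the mathematics and from 0 in 'rV[R]_n:
   the timelike coordinate, the n-th one, is the ordinal i with i.+1 = n. *)
Definition lorentz (R : realType) (n : nat) (x y : 'rV[R]_n) : R :=
  \sum_(i < n) (-1) ^+ (i.+1 == n)%N * (x 0 i * y 0 i).

Definition lorentz_norm (R : realType) (n : nat) (w : 'rV[R]_n) : R :=
  Num.sqrt `|lorentz w w|.

Definition spacelike (R : realType) (n : nat) (w : 'rV[R]_n) : Prop :=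
  0 < lorentz w w \/ w = 0.

Definition timelike (R : realType) (n : nat) (w : 'rV[R]_n) : Prop :=
  lorentz w w < 0.

(* std_vec R n k is e_k, for 1 <= k <= n. *)
Definition std_vec (R : realType) (n k : nat) : 'rV[R]_n :=
  \row_(i < n) (i.+1 == k)%N%:R.

(* xi_prev and xi_last are the null vectors xi_{n-1} and xi_n. *)
Definition xi_prev (R : realType) (n : nat) : 'rV[R]_n :=
  (Num.sqrt 2)^-1 *: (std_vec R n n - std_vec R n n.-1).

Definition xi_last (R : realType) (n : nat) : 'rV[R]_n :=
  (Num.sqrt 2)^-1 *: (std_vec R n n + std_vec R n n.-1).

(* Curves are total functions of which only the values on an open set matter;
   derivatives on an open set do not depend on the values outside it. *)
Definition smooth_on (R : realType) (V : normedModType R) (J : set R)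
    (f : R -> V) : Prop :=
  forall (k : nat) (t : R), J t -> derivable (derive1n k f) t 1.

Definition open_interval (R : realType) (J : set R) : Prop :=
  open J /\ is_interval J.

Definition spacelike_curve (R : realType) (n : nat) (J : set R)
    (a : R -> 'rV[R]_n) : Prop :=
  forall t, J t -> spacelike (derive1 a t).

Definition timelike_curve (R : realType) (n : nat) (J : set R)
    (a : R -> 'rV[R]_n) : Prop :=
  forall t, J t -> timelike (derive1 a t).

(* The profile curve beta; the coordinate function x_k is x k, and x 2 is not
   used. *)
Definition profile (R : realType) (n : nat) (x : nat -> R -> R) (u : R)
    : 'rV[R]_n :=
  x 1%N u *: std_vec R n 1
  + \sum_(3 <= k < n.-1) x k u *: std_vec R n k
  + x n.-1 u *: xi_prev R n + x n u *: xi_last R n.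

Definition unit_speed (R : realType) (n : nat) (I : set R)
    (b : R -> 'rV[R]_n) (eps : R) : Prop :=
  forall u, I u -> lorentz (derive1 b u) (derive1 b u) = eps.

Definition regular_curve (R : realType) (n : nat) (I : set R)
    (b : R -> 'rV[R]_n) : Prop :=
  forall u, I u -> derive1 b u != 0.

Definition H3 (R : realType) (n : nat) (x : nat -> R -> R) (c : R) (u v : R)
    : 'rV[R]_n :=
  x 1%N u *: std_vec R n 1
  + (Num.sqrt 2 * v * x n u) *: std_vec R n 2
  + \sum_(3 <= k < n.-1) x k u *: std_vec R n k
  + (x n.-1 u + v ^+ 2 * x n u + c * v) *: xi_prev R n
  + x n u *: xi_last R n.

Definition partial_u (R : realType) (n : nat) (H : R -> R -> 'rV[R]_n)
    (u v : R) : 'rV[R]_n := derive1 (H ^~ v) u.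

Definition partial_v (R : realType) (n : nat) (H : R -> R -> 'rV[R]_n)
    (u v : R) : 'rV[R]_n := derive1 (H u) v.

Definition timelike_surface (R : realType) (n : nat) (I : set R)
    (H : R -> R -> 'rV[R]_n) : Prop :=
  forall u v, I u ->
    let E := lorentz (partial_u H u v) (partial_u H u v) in
    let F := lorentz (partial_u H u v) (partial_v H u v) in
    let G := lorentz (partial_v H u v) (partial_v H u v) in
    E * G - F ^+ 2 < 0.

Definition spacelike_meridians (R : realType) (n : nat) (I : set R)
    (H : R -> R -> 'rV[R]_n) : Prop :=
  forall v0, spacelike_curve I (H ^~ v0).

Definition timelike_meridians (R : realType) (n : nat) (I : set R)
    (H : R -> R -> 'rV[R]_n) : Prop :=
  forall v0, timelike_curve I (H ^~ v0).

(* lorentz_angle x y theta: theta is the Lorentzian angle between x and y.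
   Pairs of vectors of any other causal type have no angle. *)
Definition lorentz_angle (R : realType) (n : nat) (x y : 'rV[R]_n)
    (theta : R) : Prop :=
  0 <= theta /\
  [\/ [/\ spacelike x, x != 0, timelike y
        & let p := lorentz_norm x * lorentz_norm y * sinh theta in
          lorentz x y = p \/ lorentz x y = - p],
      [/\ timelike x, spacelike y, y != 0
        & let p := lorentz_norm x * lorentz_norm y * sinh theta in
          lorentz x y = p \/ lorentz x y = - p]
    | [/\ timelike x, timelike y
        & let p := lorentz_norm x * lorentz_norm y * cosh theta in
          lorentz x y = p \/ lorentz x y = - p]].

Definition timelike_loxodrome (R : realType) (n : nat) (J : set R)
    (H : R -> R -> 'rV[R]_n) (u v : R -> R) (phi0 : R) : Prop :=
  let a := fun t => H (u t) (v t) in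
  timelike_curve J a /\
  forall t, J t -> lorentz_angle (derive1 a t) (partial_u H (u t) (v t)) phi0.

(* Main.v *)
(** The surface is [beta(u) + sqrt2 v x_n(u) e_2 + (v^2 x_n(u) + c v) xi_{n-1}]
    with [beta] orthogonal to [e_2] and [<beta, xi_{n-1}> = - x_n].  Hence
    E = eps, F = - c x_n', G = 2 x_n^2.  With [L = <alpha', alpha'>], the angle
    condition squares to [<alpha', H_u>^2 = - L sinh^2 phi0] (resp. [cosh^2]),
    which is the differential equation.  Conversely the equation gives
    [L <= 0]; if [L = 0] then [<alpha', H_u> = 0], which for eps = 1 contradicts
    EG - F^2 < 0 and for eps = -1 makes [L] a sum of squares containing
    [u'^2 > 0]. *)
Require Import Defs.
From mathcomp Require Import all_boot all_order all_algebra.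
From mathcomp Require Import all_classical all_reals all_analysis.
From mathcomp Require Import ring lra zify.
Import Order.TTheory GRing.Theory Num.Theory.
Import numFieldNormedType.Exports.
Set Implicit Arguments.
Unset Strict Implicit.
Unset Printing Implicit Defensive.
Local Open Scope classical_set_scope.
Local Open Scope ring_scope.

(** * Hyperbolic functions *)

Lemma sinh_gt0 (R : realType) (x : R) : 0 < x -> 0 < sinh x.
Proof.
by move=> x0; rewrite /sinh divr_gt0// subr_gt0 ltr_expR; lra.
Qed.

Lemma sqr_cosh (R : realType) (x : R) : cosh x ^+ 2 = 1 + sinh x ^+ 2.
Proof.
have e : expR x * expR (- x) = 1 by rewrite -expRD subrr expR0.
rewrite /cosh /sinh.
transitivity (expR x * expR (- x) + ((expR x - expR (- x)) / 2) ^+ 2).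
  by field.
by rewrite e.
Qed.

(** * Bilinearity of the Lorentzian product *)

Lemma lorentzC (R : realType) (n : nat) (x y : 'rV[R]_n) :
  lorentz x y = lorentz y x.
Proof. by apply: eq_bigr => i _; rewrite (mulrC (x 0 i)). Qed.

Lemma lorentzDl (R : realType) (n : nat) (x y z : 'rV[R]_n) :
  lorentz (x + y) z = lorentz x z + lorentz y z.
Proof.
by rewrite -big_split; apply: eq_bigr => i _; rewrite mxE mulrDl mulrDr.
Qed.

Lemma lorentzZl (R : realType) (n : nat) (k : R) (x y : 'rV[R]_n) :
  lorentz (k *: x) y = k * lorentz x y.
Proof.
by rewrite /lorentz big_distrr; apply: eq_bigr => i _; rewrite mxE /=; ring.
Qed.

Lemma lorentzDr (R : realType) (n : nat) (x y z : 'rV[R]_n) :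
  lorentz x (y + z) = lorentz x y + lorentz x z.
Proof. by rewrite lorentzC lorentzDl !(lorentzC x). Qed.

Lemma lorentzZr (R : realType) (n : nat) (k : R) (x y : 'rV[R]_n) :
  lorentz x (k *: y) = k * lorentz x y.
Proof. by rewrite lorentzC lorentzZl lorentzC. Qed.

Lemma lorentzBl (R : realType) (n : nat) (x y z : 'rV[R]_n) :
  lorentz (x - y) z = lorentz x z - lorentz y z.
Proof. by rewrite -scaleN1r lorentzDl lorentzZl mulN1r. Qed.

Lemma lorentzBr (R : realType) (n : nat) (x y z : 'rV[R]_n) :
  lorentz x (y - z) = lorentz x y - lorentz x z.
Proof. by rewrite lorentzC lorentzBl !(lorentzC x). Qed.

Lemma lorentz0l (R : realType) (n : nat) (y : 'rV[R]_n) : lorentz 0 y = 0.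
Proof. by rewrite -(scale0r (0 : 'rV[R]_n)) lorentzZl mul0r. Qed.

Lemma lorentz_suml (R : realType) (n : nat) (r : seq nat) (P : pred nat)
    (F : nat -> 'rV[R]_n) (y : 'rV[R]_n) :
  lorentz (\sum_(k <- r | P k) F k) y = \sum_(k <- r | P k) lorentz (F k) y.
Proof.
apply: (big_morph (fun z => lorentz z y)) => [a b|]; first exact: lorentzDl.
exact: lorentz0l.
Qed.

(** * Products of the basis vectors e_k, xi_{n-1} and xi_n *)

Lemma lorentz_std (R : realType) (n j k : nat) : (0 < k <= n)%N ->
  lorentz (std_vec R n j) (std_vec R n k)
    = (-1) ^+ (k == n)%N * (j == k)%N%:R.
Proof.
case: k => // k /= kn; rewrite /lorentz (bigD1 (Ordinal kn)) //= !mxE /= eqxx.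
rewrite mulr1 (eq_sym k.+1 j) big1 ?addr0 // => i /eqP ik.
rewrite !mxE eqSS; have -> : (nat_of_ord i == k) = false.
  by apply/eqP => e; apply: ik; apply/val_inj.
by rewrite !mulr0.
Qed.

Lemma lorentz_xi_prev (R : realType) (n : nat) : (1 < n)%N ->
  lorentz (xi_prev R n) (xi_prev R n) = 0.
Proof.
move=> n1; rewrite /xi_prev !(lorentzZl, lorentzZr, lorentzBl, lorentzBr).
rewrite !lorentz_std ?eqxx; [|lia..].
have -> : (n == n.-1) = false by lia.
have -> : (n.-1 == n) = false by lia.
by rewrite /=; ring.
Qed.

(** The cross terms vanish, leaving half of <e_n, e_n> - <e_{n-1}, e_{n-1}> = -2. *)
Lemma lorentz_xi_last_prev (R : realType) (n : nat) : (1 < n)%N ->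
  lorentz (xi_last R n) (xi_prev R n) = -1.
Proof.
move=> n1; rewrite /xi_prev /xi_last.
rewrite !(lorentzZl, lorentzZr, lorentzDl, lorentzBr).
rewrite !lorentz_std ?eqxx; [|lia..].
have -> : (n == n.-1) = false by lia.
have -> : (n.-1 == n) = false by lia.
rewrite -mulrDr mulrA -invfM -expr2 sqr_sqrtr ?ler0n //=.
by field.
Qed.

Lemma lorentz_std_xi_prev (R : realType) (n k : nat) : (0 < k < n.-1)%N ->
  lorentz (std_vec R n k) (xi_prev R n) = 0.
Proof.
move=> kn; rewrite /xi_prev lorentzZr lorentzBr !lorentz_std; [|lia..].
have -> : (k == n.-1) = false by lia.
have -> : (k == n) = false by lia.
by rewrite !mulr0 subrr mulr0.
Qed.

Lemma lorentz_std_xi_last (R : realType) (n k : nat) : (0 < k < n.-1)%N ->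
  lorentz (std_vec R n k) (xi_last R n) = 0.
Proof.
move=> kn; rewrite /xi_last lorentzZr lorentzDr !lorentz_std; [|lia..].
have -> : (k == n.-1) = false by lia.
have -> : (k == n) = false by lia.
by rewrite !mulr0 addr0 mulr0.
Qed.

(** * The profile curve paired with e_2 and xi_{n-1} *)

Lemma lorentz_profile_std2 (R : realType) (n : nat) (x : nat -> R -> R)
    (u : R) : (3 < n)%N ->
  lorentz (profile n x u) (std_vec R n 2) = 0.
Proof.
move=> n3.
have hp : lorentz (xi_prev R n) (std_vec R n 2) = 0.
  by rewrite lorentzC lorentz_std_xi_prev //; lia.
have hl : lorentz (xi_last R n) (std_vec R n 2) = 0.
  by rewrite lorentzC lorentz_std_xi_last //; lia.
(* Both null vectors become opaque, so that they enter the expansion only through the products just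
   computed. *)
rewrite /profile; move: (xi_prev R n) (xi_last R n) hp hl => p q hp hl.
rewrite !lorentzDl lorentz_suml !lorentzZl hp hl lorentz_std; last by lia.
(* The sum starts at k = 3 and so contains no e_2 term. *)
rewrite big_nat big1 => [|k k3]; last first.
  by rewrite lorentzZl lorentz_std; [case: k k3 => [|[|[|k]]] //= _; ring|lia].
by rewrite /=; ring.
Qed.

(** Among the vectors spanning the profile, xi_{n-1} has a nonzero product only with xi_n, so this
    pairing reads off the last coordinate. *)
Lemma lorentz_profile_xi_prev (R : realType) (n : nat) (x : nat -> R -> R)
    (u : R) : (3 < n)%N ->
  lorentz (profile n x u) (xi_prev R n) = - x n u.
Proof.
move=> n3.
have hs k : (0 < k < n.-1)%N -> lorentz (std_vec R n k) (xi_prev R n) = 0.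
  exact: lorentz_std_xi_prev.
have hp : lorentz (xi_prev R n) (xi_prev R n) = 0.
  by rewrite lorentz_xi_prev //; lia.
have hl : lorentz (xi_last R n) (xi_prev R n) = -1.
  by rewrite lorentz_xi_last_prev //; lia.
rewrite /profile; move: (xi_prev R n) (xi_last R n) hs hp hl => p q hs hp hl.
rewrite !lorentzDl lorentz_suml !lorentzZl hp hl hs; last by lia.
rewrite big_nat big1 => [|k k3]; last by rewrite lorentzZl hs ?mulr0 //; lia.
ring.
Qed.

(** Isolates the profile curve, the object whose smoothness and speed are given, from the terms
    produced by the helicoidal motion. *)
Lemma H3E (R : realType) (n : nat) (x : nat -> R -> R) (c u v : R) :
  H3 n x c u v = profile n x u + (Num.sqrt 2 * v * x n u) *: std_vec R n 2
    + (v ^+ 2 * x n u + c * v) *: xi_prev R n.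
Proof.
rewrite /H3 /profile -(addrA (x n.-1 u)) [(x n.-1 u + _) *: _]scalerDl.
by apply/rowP => i; rewrite !mxE; ring.
Qed.

(** * Derivatives of vector curves, of the profile and of the surface *)

Lemma is_derive_rowP (R : realType) (n : nat) (M : R -> 'rV[R]_n)
    (D : 'rV[R]_n) (t : R) :
  is_derive t 1 M D <-> forall j, is_derive t 1 (fun s => M s 0 j) (D 0 j).
Proof.
split=> [[dM <-] j|dM].
  split; first by move/derivable_mxP: dM; apply.
  by rewrite derive_mx// mxE.
have dM' : derivable M t 1.
  by apply/derivable_mxP => i j; rewrite ord1; case: (dM j).
split=> //; rewrite derive_mx//; apply/rowP => j; rewrite mxE.
by case: (dM j).
Qed.

(** For fixed [w] the product is a linear combination of the coordinates with constant coefficients.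
    This turns identities for the profile into identities for its velocity. *)
Lemma is_derive_lorentzl (R : realType) (n : nat) (b : R -> 'rV[R]_n)
    (db w : 'rV[R]_n) (t : R) :
  is_derive t 1 b db ->
  is_derive t 1 (fun s => lorentz (b s) w) (lorentz db w).
Proof.
move=> /is_derive_rowP hb.
rewrite (_ : (fun s => _) =
  \sum_(i < n) (fun s => (-1) ^+ (i.+1 == n)%N * w 0 i * b s 0 i)).
  rewrite /lorentz; apply: is_derive_sum => i.
  apply: (is_derive_eq (is_deriveZ ((-1) ^+ (i.+1 == n)%N * w 0 i) (hb i))).
  by rewrite /GRing.scale /=; ring.
apply/funext => s; rewrite fct_sumE; apply: eq_bigr => i _; ring.
Qed.

Lemma is_derive_row_comp (R : realType) (n : nat) (b : R -> 'rV[R]_n)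
    (db : 'rV[R]_n) (u : R -> R) (du t : R) :
  is_derive (u t) 1 b db -> is_derive t 1 u du ->
  is_derive t 1 (fun s => b (u s)) (du *: db).
Proof.
move=> /is_derive_rowP hb hu; apply/is_derive_rowP => j.
by rewrite mxE mulrC; apply: (is_derive1_comp (hb j) hu).
Qed.

Lemma is_derive_scalel (R : realType) (n : nat) (f : R -> R) (df : R)
    (w : 'rV[R]_n) (t : R) :
  is_derive t 1 f df -> is_derive t 1 (fun s => f s *: w) (df *: w).
Proof.
move=> hf; apply/is_derive_rowP => j; rewrite mxE.
rewrite (_ : (fun s => _) = (fun s => w 0 j * f s)); last first.
  by apply/funext => s; rewrite mxE mulrC.
by apply: (is_derive_eq (is_deriveZ (w 0 j) hf)); rewrite /GRing.scale /= mulrC.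
Qed.

(** Smoothness is given for the profile as a vector curve; the coordinate x_n inherits it through
    x_n = - <beta, xi_{n-1}>. *)
Lemma is_derive_xn (R : realType) (n : nat) (x : nat -> R -> R)
    (db : 'rV[R]_n) (u : R) : (3 < n)%N ->
  is_derive u 1 (profile n x) db ->
  is_derive u 1 (x n) (- lorentz db (xi_prev R n)).
Proof.
move=> n3 hb.
rewrite (_ : x n = - (fun s => lorentz (profile n x s) (xi_prev R n))).
  exact: is_deriveN (is_derive_lorentzl (xi_prev R n) hb).
by apply/funext => s; rewrite fctE lorentz_profile_xi_prev// opprK.
Qed.

(** The function <beta, e_2> vanishes identically, hence so does its derivative. *)
Lemma lorentz_dprofile_std2 (R : realType) (n : nat) (x : nat -> R -> R)
    (db : 'rV[R]_n) (u : R) : (3 < n)%N ->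
  is_derive u 1 (profile n x) db -> lorentz db (std_vec R n 2) = 0.
Proof.
move=> n3 hb; have [_ <-] := is_derive_lorentzl (std_vec R n 2) hb.
rewrite (_ : (fun s => _) = cst 0) ?derive_cst//.
by apply/funext => s; rewrite lorentz_profile_std2.
Qed.

(* The partial derivatives of [H3], where [db] and [dx] are the derivatives of
   the profile curve and of [x n] at [u], and [xn] is [x n u]. *)
Definition dH3u (R : realType) (n : nat) (db : 'rV[R]_n) (dx v : R) :=
  db + (Num.sqrt 2 * v * dx) *: std_vec R n 2 + (v ^+ 2 * dx) *: xi_prev R n.

Definition dH3v (R : realType) (n : nat) (xn c v : R) :=
  (Num.sqrt 2 * xn) *: std_vec R n 2 + (2 * v * xn + c) *: xi_prev R n.

(** One chain rule serves three purposes: a constant [v] or a constant [u] gives the partial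
    derivatives, and a general pair gives the velocity of a curve on the surface. *)
Lemma is_derive_H3 (R : realType) (n : nat) (x : nat -> R -> R) (c : R)
    (db : 'rV[R]_n) (u v : R -> R) (dx du dv t : R) :
  is_derive (u t) 1 (profile n x) db -> is_derive (u t) 1 (x n) dx ->
  is_derive t 1 u du -> is_derive t 1 v dv ->
  is_derive t 1 (fun s => H3 n x c (u s) (v s))
    (du *: dH3u db dx (v t) + dv *: dH3v n (x n (u t)) c (v t)).
Proof.
move=> hb hx hu hv.
have hxu : is_derive t 1 (x n \o u) (dx * du) by apply: is_derive1_comp.
have h2 : is_derive t 1 (fun s => Num.sqrt 2 * v s * x n (u s))
    (Num.sqrt 2 * (v t * (dx * du) + x n (u t) * dv)).
  rewrite (_ : (fun s => _) = Num.sqrt 2 \*: (v * (x n \o u))).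
    exact: is_deriveZ (is_deriveM hv hxu).
  by apply/funext => s; rewrite /= /GRing.scale /= !fctE mulrA.
have h1 : is_derive t 1 (fun s => v s ^+ 2 * x n (u s) + c * v s)
    (v t ^+ 2 * (dx * du) + x n (u t) * (2 * v t * dv) + c * dv).
  rewrite (_ : (fun s => _) = v ^+ 2 * (x n \o u) + c \*: v).
    apply: (is_derive_eq
      (is_deriveD (is_deriveM (is_deriveX 2 hv) hxu) (is_deriveZ c hv))).
    by rewrite /GRing.scale /= expr1 fctE.
  by apply/funext => s; rewrite /= /GRing.scale /= !fctE.
rewrite (_ : (fun s => _) = (fun s => profile n x (u s))
   + (fun s => (Num.sqrt 2 * v s * x n (u s)) *: std_vec R n 2)
   + (fun s => (v s ^+ 2 * x n (u s) + c * v s) *: xi_prev R n)); last first.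
  by apply/funext => s; rewrite H3E !fctE.
apply: (is_derive_eq (is_deriveD
  (is_deriveD (is_derive_row_comp hb hu) (is_derive_scalel (std_vec R n 2) h2))
  (is_derive_scalel (xi_prev R n) h1))).
by apply/rowP => j; rewrite !mxE; ring.
Qed.

(** * The first fundamental form *)

Section fundamental_form.
Context (R : realType) (n : nat) (db : 'rV[R]_n) (eps c dx xn v : R).
Hypotheses (n3 : (3 < n)%N) (db2 : lorentz db (std_vec R n 2) = 0)
  (dbxi : lorentz db (xi_prev R n) = - dx) (dbdb : lorentz db db = eps).

Let sqrt2 : (Num.sqrt 2 : R) ^+ 2 = 2.
Proof. by rewrite sqr_sqrtr. Qed.

Let forms : [/\ lorentz (xi_prev R n) (xi_prev R n) = 0,
  lorentz (std_vec R n 2) (xi_prev R n) = 0 &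
  lorentz (std_vec R n 2) (std_vec R n 2) = 1].
Proof.
split; first by rewrite lorentz_xi_prev //; lia.
  by rewrite lorentz_std_xi_prev //; lia.
rewrite lorentz_std; last by lia.
have -> : (2 == n)%N = false by lia.
by rewrite mulr1.
Qed.

(** The e_2 component contributes 2 v^2 dx^2, which cancels the cross term 2 v^2 dx <db, xi_{n-1}> =
    - 2 v^2 dx^2. *)
Lemma lorentz_dH3uu : lorentz (dH3u db dx v) (dH3u db dx v) = eps.
Proof.
have [] := forms; rewrite /dH3u.
move: (xi_prev R n) (std_vec R n 2) dbxi db2 => p e hp he hpp hep hee.
rewrite !(lorentzDl, lorentzDr, lorentzZl, lorentzZr).
rewrite !(lorentzC p) !(lorentzC e db) hp he hpp hep hee dbdb.
by ring: sqrt2.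
Qed.

(** The e_2 components contribute 2 v dx xn, which cancels against <db, (2 v xn + c) xi_{n-1}> up to
    the pitch term - c dx. *)
Lemma lorentz_dH3uv : lorentz (dH3u db dx v) (dH3v n xn c v) = - (c * dx).
Proof.
have [] := forms; rewrite /dH3u /dH3v.
move: (xi_prev R n) (std_vec R n 2) dbxi db2 => p e hp he hpp hep hee.
rewrite !(lorentzDl, lorentzDr, lorentzZl, lorentzZr).
rewrite !(lorentzC p) hp he hpp hep hee.
by ring: sqrt2.
Qed.

Lemma lorentz_dH3vv : lorentz (dH3v n xn c v) (dH3v n xn c v) = 2 * xn ^+ 2.
Proof.
have [] := forms; rewrite /dH3v.
move: (xi_prev R n) (std_vec R n 2) => p e hpp hep hee.
rewrite !(lorentzDl, lorentzDr, lorentzZl, lorentzZr).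
rewrite !(lorentzC p) hpp hep hee.
by ring: sqrt2.
Qed.

End fundamental_form.

(** * The Lorentzian angle as a quadratic condition *)

Lemma sqr_lorentz_norm (R : realType) (n : nat) (w : 'rV[R]_n) :
  lorentz_norm w ^+ 2 = `|lorentz w w|.
Proof. by rewrite sqr_sqrtr. Qed.

(** The sign ambiguity in the definition of the angle is exactly what squaring forgets, so squaring
    gives an equivalence. *)
Lemma eq_or_oppE (R : realType) (a b : R) :
  (a = b \/ a = - b) <-> a ^+ 2 = b ^+ 2.
Proof.
split=> [[->|->]|/eqP]; rewrite ?sqrrN//.
by rewrite eqf_sqr => /orP[] /eqP; [left|right].
Qed.

(** Only the timelike-spacelike clause of the angle can apply, and there the squared norms are - <w,
    w> and 1. *)
Lemma lorentz_angle_spacelike (R : realType) (n : nat) (w y : 'rV[R]_n)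
    (phi : R) : 0 <= phi -> timelike w -> lorentz y y = 1 ->
  lorentz_angle w y phi <->
  lorentz w y ^+ 2 = - lorentz w w * sinh phi ^+ 2.
Proof.
move=> phi0 tw yy.
have -> : - lorentz w w * sinh phi ^+ 2 =
    (lorentz_norm w * lorentz_norm y * sinh phi) ^+ 2.
  by rewrite !exprMn !sqr_lorentz_norm yy normr1 (ltr0_norm tw) mulr1.
rewrite -eq_or_oppE; split=> [[_]|h].
  have nty : ~ timelike y by rewrite /timelike yy ltr10.
  by case=> [[_ _ /nty]|[]|[_ /nty]].
split=> //; apply: Or32; split=> //; first by left; rewrite yy.
apply/eqP => y0; move: yy; rewrite y0 lorentz0l => /esym/eqP.
by rewrite oner_eq0.
Qed.

Lemma lorentz_angle_timelike (R : realType) (n : nat) (w y : 'rV[R]_n)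
    (phi : R) : 0 <= phi -> timelike w -> lorentz y y = -1 ->
  lorentz_angle w y phi <->
  lorentz w y ^+ 2 = - lorentz w w * cosh phi ^+ 2.
Proof.
move=> phi0 tw yy.
have ty : timelike y by rewrite /timelike yy ltrN10.
(* The two mixed clauses ask for a nonzero spacelike vector, which neither [w] nor [y] can be; the
   cosh clause remains. *)
have nspace (z : 'rV[R]_n) : timelike z -> spacelike z -> z = 0.
  by rewrite /timelike => z0 [/ltW|//]; rewrite leNgt z0.
have -> : - lorentz w w * cosh phi ^+ 2 =
    (lorentz_norm w * lorentz_norm y * cosh phi) ^+ 2.
  by rewrite !exprMn !sqr_lorentz_norm yy normrN1 (ltr0_norm tw) mulr1.
rewrite -eq_or_oppE; split=> [[_]|h].
  case=> [[sw w0]|[_ sy y0]|[]//].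
    by rewrite (nspace _ tw sw) eqxx in w0.
  by rewrite (nspace _ ty sy) eqxx in y0.
by split=> //; apply: Or33.
Qed.

(** * The differential equation as real algebra *)

Section loxodrome_equation.
Context (R : realType).
(** Dictionary: [p], [q] are the derivatives of u, v; [g], [d] are x_n and its derivative; [s], [k]
    are sinh and cosh of the angle. In both lemmas [L] is the squared velocity of the curve. *)
Variables (p q c d g s k : R).
Hypotheses (p0 : p != 0) (s0 : 0 < s) (k2 : k ^+ 2 = 1 + s ^+ 2).

Lemma loxodrome_equation_spacelike : 2 * g ^+ 2 - (c * d) ^+ 2 < 0 ->
  let L := p ^+ 2 - 2 * (c * d) * p * q + 2 * g ^+ 2 * q ^+ 2 in
  (L < 0 /\ (p - c * d * q) ^+ 2 = - L * s ^+ 2) <->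
  (2 * s ^+ 2 * g ^+ 2 + c ^+ 2 * d ^+ 2) * q ^+ 2
    - 2 * c * k ^+ 2 * d * p * q + k ^+ 2 * p ^+ 2 = 0.
Proof.
move=> surf L; rewrite k2.
(* The left side of the equation is the difference of the two sides of the squared angle
   condition. *)
have -> : (2 * s ^+ 2 * g ^+ 2 + c ^+ 2 * d ^+ 2) * q ^+ 2
    - 2 * c * (1 + s ^+ 2) * d * p * q + (1 + s ^+ 2) * p ^+ 2
    = (p - c * d * q) ^+ 2 - - L * s ^+ 2 by rewrite /L; ring.
split=> [[_ ->]|/eqP]; first by rewrite subrr.
rewrite subr_eq0 => /eqP eL; split=> //.
have s2 : 0 < s ^+ 2 by rewrite exprn_gt0.
have : 0 <= - L by rewrite -(pmulr_lge0 _ s2) -eL sqr_ge0.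
rewrite oppr_ge0 le_eqVlt => /orP[/eqP L0|//].
have /eqP : (p - c * d * q) ^+ 2 = 0 by rewrite eL L0 oppr0 mul0r.
rewrite sqrf_eq0 subr_eq0 => /eqP pE.
(* Putting p = c d q into L = 0 leaves (EG - F^2) q^2 = 0, so q = 0 and then p = 0. *)
have : (2 * g ^+ 2 - (c * d) ^+ 2) * q ^+ 2 = 0.
  by rewrite -[RHS]L0 /L pE; ring.
move/eqP; rewrite mulf_eq0 (lt_eqF surf) sqrf_eq0 /= => /eqP q0.
by move: p0; rewrite pE q0 mulr0 eqxx.
Qed.

Lemma loxodrome_equation_timelike :
  let L := - p ^+ 2 - 2 * (c * d) * p * q + 2 * g ^+ 2 * q ^+ 2 in
  (L < 0 /\ (- p - c * d * q) ^+ 2 = - L * k ^+ 2) <->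
  (2 * k ^+ 2 * g ^+ 2 + c ^+ 2 * d ^+ 2) * q ^+ 2
    - 2 * c * s ^+ 2 * d * p * q - s ^+ 2 * p ^+ 2 = 0.
Proof.
move=> L.
have -> : (2 * k ^+ 2 * g ^+ 2 + c ^+ 2 * d ^+ 2) * q ^+ 2
    - 2 * c * s ^+ 2 * d * p * q - s ^+ 2 * p ^+ 2
    = (- p - c * d * q) ^+ 2 - - L * k ^+ 2 by rewrite /L k2; ring.
split=> [[_ ->]|/eqP]; first by rewrite subrr.
rewrite subr_eq0 => /eqP eL; split=> //.
have k2_gt0 : 0 < k ^+ 2 by rewrite k2 ltr_pwDl// sqr_ge0.
have : 0 <= - L by rewrite -(pmulr_lge0 _ k2_gt0) -eL sqr_ge0.
rewrite oppr_ge0 le_eqVlt => /orP[/eqP L0|//].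
have /eqP : (- p - c * d * q) ^+ 2 = 0 by rewrite eL L0 oppr0 mul0r.
rewrite sqrf_eq0 subr_eq0 => /eqP pE.
have LE : L = p ^+ 2 + 2 * g ^+ 2 * q ^+ 2.
  (* Isolating c d q allows the substitution c d q = - p, which turns - p^2 into + p^2. *)
  have -> : L = - p ^+ 2 - 2 * p * (c * d * q) + 2 * g ^+ 2 * q ^+ 2.
    by rewrite /L; ring.
  by rewrite -pE; ring.
have : 0 < L.
  rewrite LE ltr_pwDl //; last first.
    exact: mulr_ge0 (mulr_ge0 (ler0n _ 2) (sqr_ge0 g)) (sqr_ge0 q).
  by rewrite lt_neqAle sqr_ge0 eq_sym sqrf_eq0 p0.
by rewrite L0 ltxx.
Qed.

End loxodrome_equation.

(** * The geometric equivalence, assembled from the pointwise algebra *)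

Theorem lemma5p1 (R : realType) (n : nat) (hn : (4 <= n)%N)
    (I : set R) (hI : open_interval I)
    (x : nat -> R -> R) (eps c : R)
    (heps : eps = 1 \/ eps = -1) (hc : 0 < c)
    (hsmooth : smooth_on I (profile n x))
    (hregular : regular_curve I (profile n x))
    (hspeed : unit_speed I (profile n x) eps)
    (hM : timelike_surface I (H3 n x c))
    (phi0 : R) (hphi0 : 0 < phi0)
    (J : set R) (hJ : open_interval J) (u v : R -> R)
    (hu : smooth_on J u) (hv : smooth_on J v)
    (huI : forall t, J t -> I (u t))
    (hu' : forall t, J t -> derive1 u t != 0) :
  (spacelike_meridians I (H3 n x c) ->
     (timelike_loxodrome J (H3 n x c) u v phi0 <->
      forall t, J t ->
        (2 * sinh phi0 ^+ 2 * x n (u t) ^+ 2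
           + c ^+ 2 * derive1 (x n) (u t) ^+ 2) * derive1 v t ^+ 2
        - 2 * c * cosh phi0 ^+ 2 * derive1 (x n) (u t) * derive1 u t * derive1 v t
        + cosh phi0 ^+ 2 * derive1 u t ^+ 2 = 0))
  /\
  (timelike_meridians I (H3 n x c) ->
     (timelike_loxodrome J (H3 n x c) u v phi0 <->
      forall t, J t ->
        (2 * cosh phi0 ^+ 2 * x n (u t) ^+ 2
           + c ^+ 2 * derive1 (x n) (u t) ^+ 2) * derive1 v t ^+ 2
        - 2 * c * sinh phi0 ^+ 2 * derive1 (x n) (u t) * derive1 u t * derive1 v t
        - sinh phi0 ^+ 2 * derive1 u t ^+ 2 = 0)).
Proof.
have D1 (V : normedModType R) (f : R -> V) (s : R) :
    derivable f s 1 -> is_derive s 1 f (derive1 f s).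
  by move=> df; split=> //; rewrite derive1E.
have D1E (V : normedModType R) (f : R -> V) (s : R) (df : V) :
    is_derive s 1 f df -> derive1 f s = df.
  by case=> _ <-; rewrite derive1E.
(* Order 0 of smoothness is differentiability of the curve itself. *)
have hb w : I w -> is_derive w 1 (profile n x) (derive1 (profile n x) w).
  by move=> Iw; apply: D1; exact: (hsmooth 0%N).
have hx w : I w -> is_derive w 1 (x n) (derive1 (x n) w).
  by move=> /hb /(is_derive_xn hn) []/D1.
have hdx w : I w ->
    lorentz (derive1 (profile n x) w) (xi_prev R n) = - derive1 (x n) w.
  by move=> /hb /(is_derive_xn hn) /D1E ->; rewrite opprK.
have hd2 w : I w -> lorentz (derive1 (profile n x) w) (std_vec R n 2) = 0.
  by move=> /hb /(lorentz_dprofile_std2 hn).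
have Hu w z : I w -> partial_u (H3 n x c) w z
    = dH3u (derive1 (profile n x) w) (derive1 (x n) w) z.
  move=> Iw; apply: D1E.
  have := is_derive_H3 c (hb _ Iw) (hx _ Iw) (is_derive_id w 1)
    (is_derive_cst z w 1).
  by rewrite scale1r scale0r addr0.
have Hv w z : I w -> partial_v (H3 n x c) w z = dH3v n (x n w) c z.
  move=> Iw; apply: D1E.
  have := @is_derive_H3 _ _ _ c _ (cst w) id _ _ _ z (hb _ Iw) (hx _ Iw)
    (is_derive_cst w z 1) (is_derive_id z 1).
  by rewrite scale1r scale0r add0r.
have uu w z : I w -> lorentz (partial_u (H3 n x c) w z)
    (partial_u (H3 n x c) w z) = eps.
  by move=> Iw; rewrite Hu//; apply: lorentz_dH3uu; rewrite ?hdx ?hd2 ?hspeed.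
have uv w z : I w -> lorentz (partial_u (H3 n x c) w z)
    (partial_v (H3 n x c) w z) = - (c * derive1 (x n) w).
  by move=> Iw; rewrite Hu// Hv//; apply: lorentz_dH3uv; rewrite ?hdx ?hd2.
have vv w z : I w -> lorentz (partial_v (H3 n x c) w z)
    (partial_v (H3 n x c) w z) = 2 * x n w ^+ 2.
  by move=> Iw; rewrite Hv// lorentz_dH3vv.
have alpha t : J t -> derive1 (fun s => H3 n x c (u s) (v s)) t =
    derive1 u t *: partial_u (H3 n x c) (u t) (v t)
    + derive1 v t *: partial_v (H3 n x c) (u t) (v t).
  move=> Jt; have Iu := huI _ Jt; rewrite Hu// Hv//; apply: D1E.
  exact: (is_derive_H3 c (hb _ Iu) (hx _ Iu)
    (D1 _ _ _ (hu 0%N t Jt)) (D1 _ _ _ (hv 0%N t Jt))).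
(* This is E u'^2 + 2 F u' v' + G v'^2 for the coefficients found above; [au] below is E u' + F
   v'. *)
have aa t : J t -> let da := derive1 (fun s => H3 n x c (u s) (v s)) t in
    lorentz da da = eps * derive1 u t ^+ 2
      - 2 * (c * derive1 (x n) (u t)) * derive1 u t * derive1 v t
      + 2 * x n (u t) ^+ 2 * derive1 v t ^+ 2.
  move=> Jt; have Iu := huI _ Jt; rewrite /= alpha//.
  move: (uu _ (v t) Iu) (uv _ (v t) Iu) (vv _ (v t) Iu).
  move: (partial_u _ _ _) (partial_v _ _ _) => a b aa ab bb.
  rewrite !(lorentzDl, lorentzDr, lorentzZl, lorentzZr) (lorentzC b a).
  by rewrite aa ab bb; ring.
have au t : J t -> let da := derive1 (fun s => H3 n x c (u s) (v s)) t in
    lorentz da (partial_u (H3 n x c) (u t) (v t)) =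
    eps * derive1 u t - (c * derive1 (x n) (u t)) * derive1 v t.
  move=> Jt; have Iu := huI _ Jt; rewrite /= alpha//.
  move: (uu _ (v t) Iu) (uv _ (v t) Iu).
  move: (partial_u _ _ _) (partial_v _ _ _) => a b uu_t uv_t.
  by rewrite lorentzDl !lorentzZl (lorentzC b a) uu_t uv_t; ring.
have sh0 := sinh_gt0 hphi0.
(* Causality and the angle are two separate universal conditions on the curve; joined at each t,
   they reduce the theorem to a pointwise equivalence. *)
have loxE (eqn : R -> Prop) :
    (forall t, J t -> (timelike (derive1 (fun s => H3 n x c (u s) (v s)) t) /\
      lorentz_angle (derive1 (fun s => H3 n x c (u s) (v s)) t)
        (partial_u (H3 n x c) (u t) (v t)) phi0) <-> eqn t) ->
    timelike_loxodrome J (H3 n x c) u v phi0 <-> forall t, J t -> eqn t.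
  move=> h; split=> [[h1 h2] t Jt|h1].
    by apply/h => //; split; [exact: h1|exact: h2].
  by split=> t Jt; have /h := h1 t Jt; move=> /(_ Jt) [].
split=> mer; apply: loxE => t Jt; have Iu := huI _ Jt.
  (* Since E = [eps], the meridian through the current point decides the sign; the zero vector
     allowed as spacelike is excluded because its square is not -1. *)
  have eps1 : eps = 1.
    case: heps => // eN; have := mer (v t) _ Iu.
    have := uu (u t) (v t) Iu; rewrite /partial_u eN => e [|].
      by rewrite e ltr0N1.
    by move=> w0; rewrite w0 lorentz0l in e; lra.
  (* This is EG - F^2 at the current point, where the sign of F disappears in the square. *)
  have surf : 2 * x n (u t) ^+ 2 - (c * derive1 (x n) (u t)) ^+ 2 < 0.
    move: (hM _ (v t) Iu) => /=; rewrite (uu _ _ Iu) (uv _ _ Iu) (vv _ _ Iu).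
    by rewrite eps1 mul1r sqrrN.
  apply: iff_trans (loxodrome_equation_spacelike (derive1 v t) (hu' t Jt) sh0
    (sqr_cosh phi0) surf).
  (* The polynomials are folded back into <alpha', H_u> and <alpha', alpha'>, the form in which the
     angle lemma speaks. *)
  have := aa t Jt; have := au t Jt; rewrite /= eps1 !mul1r => <- <-.
  have ang tw := @lorentz_angle_spacelike _ _ _ _ _ (ltW hphi0) tw
    (etrans (uu _ (v t) Iu) eps1).
  by split=> -[tw h]; split=> //; apply/(ang _ tw).
(* Again E = [eps], and a timelike meridian rules out the value 1. *)
have epsN1 : eps = -1.
  case: heps => // e1; have := mer (v t) _ Iu; rewrite /timelike.
  by have := uu (u t) (v t) Iu; rewrite /partial_u e1 => ->; rewrite ltr10.
apply: iff_trans (loxodrome_equation_timelike (derive1 v t) c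
  (derive1 (x n) (u t)) (x n (u t)) (hu' t Jt) (sqr_cosh phi0)).
have := aa t Jt; have := au t Jt; rewrite /= epsN1 !mulN1r => <- <-.
have ang tw := @lorentz_angle_timelike _ _ _ _ _ (ltW hphi0) tw
  (etrans (uu _ (v t) Iu) epsN1).
by split=> -[tw h]; split=> //; apply/(ang _ tw).
Qed.
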